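(* Let $p,q$ be positive integers. If $p\geq 2q$, then Maker has a winning strategy for the $(p,q)$-percolation game on $\mathbb{Z}^2$.
   Context: The $(p,q)$-percolation game on $(\Lambda,v_0)$, where $\Lambda$ is an infinite connected (multi)graph, $v_0$ is a vertex of $\Lambda$ and $p,q$ are positive integers: two players, Maker and Breaker, play in alternating turns, with Maker playing first. Initially all edges of $\Lambda$ are marked as unsafe. On each of her turns, Maker marks $p$ unsafe edges as safe; on each of his turns, Breaker takes $q$ unsafe edges and deletes them from the graph. Breaker wins if at any time in the game the component containing $v_0$ (in the graph of edges not deleted) becomes finite. If Maker is able to ensure that $v_0$ remains in an infinite component indefinitely, then she is said to have a winning strategy. If $\Lambda$ is vertex-transitive, the choice of $v_0$ does not matter and one speaks of the $(p,q)$-percolation game on $\Lambda$. The graph $\mathbb{Z}^2$ has vertex set $\mathbb{Z}^2$, with two vertices joined by an edge if and only if they lie at Euclidean distance $1$ from each other. *)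

(* Defs.v *)
From HB Require Import structures.
From mathcomp Require Import all_boot all_order all_algebra finmap.
From mathcomp Require Import boolp classical_sets functions cardinality.

Set Implicit Arguments.
Unset Strict Implicit.
Unset Printing Implicit Defensive.

Import GRing.Theory Num.Theory.

(* [ends e] has two elements for an ordinary edge, one for a loop. *)
Record multigraph := Multigraph {
  vertex : choiceType;
  edge : choiceType;
  ends : edge -> {fset vertex};
  card_ends : forall e, (1 <= #|` ends e| <= 2)%N
}.

(* [reach D v w]: v and w are joined by a walk using no edge of D. *)
Inductive reach (G : multigraph) (D : {fset edge G}) (v : vertex G) :
    vertex G -> Prop :=
| reach_refl : reach D v v
| reach_step (x y : vertex G) (e : edge G) :
    reach D v x -> e \notin D -> ends e = [fset x; y]%fset -> reach D v y.

Definition component (G : multigraph) (D : {fset edge G}) (v : vertex G) :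
    set (vertex G) :=
  [set w | reach D v w]%classic.

(* The rounds completed so far, oldest first: in the round (M, B), Maker marks
   the edges of M as safe, then Breaker deletes the edges of B. *)
Definition history (G : multigraph) := seq ({fset edge G} * {fset edge G}).

Definition safe (G : multigraph) (h : history G) : {fset edge G} :=
  (\bigcup_(r <- h) r.1)%fset.

Definition deleted (G : multigraph) (h : history G) : {fset edge G} :=
  (\bigcup_(r <- h) r.2)%fset.

Definition unsafe (G : multigraph) (h : history G) (e : edge G) : Prop :=
  e \notin safe h /\ e \notin deleted h.

Definition maker_legal (G : multigraph) (p : nat) (h : history G)
    (M : {fset edge G}) : Prop :=
  #|` M| = p /\ forall e, e \in M -> unsafe h e.

(* M is the move Maker has just made in the current round. *)
Definition breaker_legal (G : multigraph) (q : nat) (h : history G)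
    (M B : {fset edge G}) : Prop :=
  #|` B| = q /\ forall e, e \in B -> unsafe h e /\ e \notin M.

Definition strategy (G : multigraph) := history G -> {fset edge G}.

(* The histories that can arise when Maker follows S. *)
Inductive play (G : multigraph) (q : nat) (S : strategy G) :
    history G -> Prop :=
| play_nil : play q S [::]
| play_rcons (h : history G) (B : {fset edge G}) :
    play q S h -> breaker_legal q h (S h) B -> play q S (rcons h (S h, B)).

(* Maker's moves delete nothing, so it is enough to look at the component of v0
   between rounds. *)
Definition maker_winning_strategy (G : multigraph) (v0 : vertex G) (p q : nat)
    (S : strategy G) : Prop :=
  forall h, play q S h ->
    maker_legal p h (S h) /\ infinite_set (component (deleted h) v0).

Definition maker_wins (G : multigraph) (v0 : vertex G) (p q : nat) : Prop :=
  exists S : strategy G, maker_winning_strategy v0 p q S.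

Definition sqdist (x y : int * int) : int :=
  ((x.1 - y.1) ^+ 2 + (x.2 - y.2) ^+ 2)%R.

(* On integer points, Euclidean distance 1 is squared distance 1. *)
Definition is_Z2_edge (e : {fset int * int}) : bool :=
  [exists x : e, exists y : e,
    (sqdist (val x) (val y) == 1%R) && (e == [fset val x; val y]%fset)].

Definition Z2_edge := {e : {fset int * int} | is_Z2_edge e}.

Lemma card_Z2_edge (e : Z2_edge) : (1 <= #|` val e| <= 2)%N.
Proof.
case: e => e /= /existsP[x /existsP[y /andP[_ /eqP ->]]].
by rewrite cardfs2; case: (_ != _).
Qed.

Definition Z2 : multigraph :=
  @Multigraph (int * int)%type Z2_edge val card_Z2_edge.

(* Main.v *)
(** Give every unit square of the lattice an integer level; the difference
    of levels across an edge is a flow along that edge, and raising the level of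
    a set of squares adds a circulation, so the divergence never changes.  Start
    from the flow that sends one unit along each of 2q+1 consecutive rows to the
    right, issuing from a vertical segment through v0 that Maker claims in her
    first move (2q edges).  Maker keeps the flow zero on deleted edges and of
    absolute value at most one on all edges that are not safe.  A finite
    component of v0 would have zero net outflow, whereas the outflow is 2q+1.

    To restore the flow after q deletions, merge the squares on the two sides of
    each deleted edge into one region, raising the lower region to the level of
    the higher one.  Maker's invariant is that a region has at most four
    unclaimed boundary edges, at most one of them leading to a lower region.
    Merging along k edges produces a region with at most 2k+4 boundary edges, at
    most 2k+1 leading lower, and at most 2k leading lower by two or more; so 2k
    claimed edges restore the invariant.  Levels are well defined modulo 2q+1,
    which forces the flow to vanish on edges interior to a region. *)

Require Import Defs.
From mathcomp Require Import all_boot.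
From mathcomp Require Import all_order all_algebra finmap zify ring.
From mathcomp Require Import boolp classical_sets functions cardinality.

Set Implicit Arguments.
Unset Strict Implicit.
Unset Printing Implicit Defensive.

Import Order.TTheory GRing.Theory Num.Theory.

Local Open Scope fset_scope.
Local Open Scope nat_scope.

(** Serves to spend a budget of [n] claims: first on the compulsory edges [X], then on further edges
    of [Y]. *)
Lemma fset_between (T : choiceType) (X Y : {fset T}) n :
  X `<=` Y -> #|` X| <= n ->
  exists Z : {fset T},
    [/\ X `<=` Z, Z `<=` Y, #|` Z| <= n & #|` Y `\` Z| <= #|` Y| - n].
Proof.
move=> XY; case: (leqP #|` Y| n) => [Yn _|nY].
  by exists Y; rewrite fsetDv cardfs0; split.
move=> Xn; have [k kE] : exists k, #|` X| + k = n by exists (n - #|` X|); lia.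
elim: k X XY {Xn} kE => [|k IH] X XY kE.
  exists X; split=> //; first by lia.
  by rewrite cardfsDS //; lia.
have /fset0Pn[y] : Y `\` X != fset0.
  by rewrite -cardfs_gt0 cardfsDS //; lia.
rewrite in_fsetD => /andP[yX yY].
have [||Z [Z1 Z2 Z3 Z4]] := IH (y |` X).
- by rewrite fsubUset fsub1set yY.
- by rewrite cardfsU1 yX; lia.
by exists Z; split=> //; apply: fsubset_trans Z1; apply: fsubsetU1.
Qed.

(** * Levels, regions and the merging step, for an abstract planar structure *)

Section Merging.
Context (F E : choiceType) (src : E * bool -> F) (c : E * bool -> int).
Context (g : F -> int) (K : pred E) (m : nat).

(* A pair [(e, s)] is a side of the edge [e], or equivalently [e] directed so
   that this side lies on its left; [src] gives the square on that side. *)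
Definition rev (t : E * bool) := (t.1, ~~ t.2).
Definition dst t := src (rev t).

(* The flow along [t]: the initial flow [c] plus the circulation of [h]. *)
Definition fall (h : F -> int) t : int := (c t + h (src t) - h (dst t))%R.

(** The boundaries [N a] are carried as finite sets, so finiteness of the unclaimed boundary of each
    region is part of the data. *)
Definition leaving (Mk : pred E) (cl : F -> F) (N : F -> {fset E * bool}) :=
  forall a t, (t \in N a) = [&& ~~ Mk t.1, cl (src t) == a & cl (dst t) != a].

Definition steep h (A : {fset E * bool}) (j : int) :=
  [fset t in A | (j <= fall h t)%R].

(** Each of the three bounds exceeds its value at [k a = 0] by exactly [2 * k a]; hence [2 * k a]
    claims can bring all three back to that value. *)
Definition bounded h (N : F -> {fset E * bool}) (k : F -> nat) :=
  forall a, [/\ #|` N a| <= 2 * k a + 4, #|` steep h (N a) 1%R| <= 2 * k a + 1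
    & #|` steep h (N a) 2%R| <= 2 * k a].

(** Testing one side suffices: both sides of an edge of [B] lie in the same region once it is
    merged. *)
Definition load (cl : F -> F) (B : seq E) a :=
  count (fun e => cl (src (e, true)) == a) B.

(* [cl] sends a square to the label of its region, and [h + g], where [g] is a
   potential of the initial flow modulo [m], is constant modulo [m] on each
   region. *)
Definition invariant (Mk Del : pred E) :=
  exists (h : F -> int) (cl : F -> F) (lv : F -> int) (N : F -> {fset E * bool}),
  [/\ forall e, Del e -> cl (src (e, true)) = cl (src (e, false)),
      forall x, (m %| (h x + g x - lv (cl x))%R)%Z,
      forall t, ~~ Mk t.1 -> (fall h t <= 1)%R,
      leaving Mk cl N
    & bounded h N (fun=> 0)].

(* The state after merging along the edges of [B], starting from the levels
   [h0]; nothing has been claimed yet. *)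
Definition merged (Mk Del : pred E) (h0 : F -> int) (B : seq E) :=
  exists (h : F -> int) (cl : F -> F) (lv : F -> int) (N : F -> {fset E * bool}),
  [/\ forall e, Del e || (e \in B) -> cl (src (e, true)) = cl (src (e, false)),
      forall x, (m %| (h x + g x - lv (cl x))%R)%Z,
      forall x, (0 <= h x - h0 x <= (load cl B (cl x))%:Z)%R,
      leaving Mk cl N
    & bounded h N (load cl B)].

Context (c_rev : forall t, c (rev t) = (- c t)%R).
Context (c_g : forall t, ~~ K t.1 -> (m %| (c t - (g (src t) - g (dst t)))%R)%Z).

Lemma revK : involutive rev.
Proof. by case=> e s; rewrite /rev /= negbK. Qed.

Lemma dst_rev t : dst (rev t) = src t.
Proof. by rewrite /dst revK. Qed.

Lemma fall_rev h t : fall h (rev t) = (- fall h t)%R.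
Proof. by rewrite /fall c_rev dst_rev -/(dst t); lia. Qed.

Lemma in_steep h A j t : (t \in steep h A j) = (t \in A) && (j <= fall h t)%R.
Proof. by rewrite !inE. Qed.

Lemma leaving_restrict (Mk Mk' : pred E) cl N : {subset Mk <= Mk'} ->
  leaving Mk cl N ->
  leaving Mk' cl (fun a => [fset t in N a | ~~ Mk' t.1]).
Proof.
move=> sub lN a t; rewrite !inE lN andbC andbA; congr (_ && _).
by case: (boolP (Mk' _)) => //= nM; apply: contra nM; apply: sub.
Qed.

Lemma invariant_mono (Mk Mk' Del : pred E) : {subset Mk <= Mk'} ->
  invariant Mk Del -> invariant Mk' Del.
Proof.
move=> sub [h [cl [lv [N [i1 i2 i3 i4 i5]]]]].
exists h, cl, lv, (fun a => [fset t in N a | ~~ Mk' t.1]); split=> //.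
- by move=> t nM; apply: i3; apply: contra nM; apply: sub.
- exact: leaving_restrict i4.
move=> a; have [b1 b2 b3] := i5 a.
split; [apply: leq_trans b1|apply: leq_trans b2|apply: leq_trans b3];
  apply/fsubset_leq_card/fsubsetP=> t; rewrite ?in_steep !inE.
- by case/andP.
- by case/andP=> /andP[-> _] ->.
- by case/andP=> /andP[-> _] ->.
Qed.

(** Raising the region [a] by the fall [d] across [e] makes the flow on [e] vanish. Both [t0] and
    [rev t0] become interior, so boundaries of at most [2i+4] and [2j+4] darts leave at most
    [2(i+j+1)+4], where [i] and [j] are the loads of [a] and [b]. *)
Lemma merged_step_lt (Mk Del : pred E) h0 B (e : E) s :
  {subset K <= Mk} -> ~~ Mk e -> (forall t, ~~ Mk t.1 -> (fall h0 t <= 1)%R) ->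
  forall (h : F -> int) (cl : F -> F) (lv : F -> int) N,
  (forall e, Del e || (e \in B) -> cl (src (e, true)) = cl (src (e, false))) ->
  (forall x, (m %| (h x + g x - lv (cl x))%R)%Z) ->
  (forall x, (0 <= h x - h0 x <= (load cl B (cl x))%:Z)%R) ->
  leaving Mk cl N -> bounded h N (load cl B) ->
  cl (src (e, s)) != cl (dst (e, s)) -> (0 <= fall h (e, s))%R ->
  merged Mk Del h0 (e :: B).
Proof.
move=> KM eM d1 h cl lv N i1 i2 i3 i4 i5.
set t0 := (e, s); set b := cl (src t0); set a := cl (dst t0) => ba d0.
set d := fall h t0 in d0.
pose cl' x := if cl x == a then b else cl x.
pose h' x := if cl x == a then (h x + d)%R else h x.
pose N' x := if x == a then fset0 else
  if x == b then [fset t in N a `|` N b | (cl (dst t) != a) && (cl (dst t) != b)]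
  else N x.
have ed : cl' (src (e, true)) = b /\ cl' (src (e, false)) = b.
  rewrite /cl'; move: ba; rewrite /b /a /dst /t0 /rev /=.
  by case: s {t0 b a d d0 cl' h' N'} => /= /negbTE; rewrite eqxx => ->.
have loadb : load cl' (e :: B) b = load cl B a + load cl B b + 1.
  rewrite /load /= ed.1 eqxx add1n addn1; congr _.+1.
  rewrite -count_predUI [X in _ + X](eq_count (a2 := pred0)) => [|f /=].
    rewrite count_pred0 addn0; apply: eq_count => f /=; rewrite /cl'.
    by case: (eqVneq (cl _) a) => //= _; rewrite eqxx.
  by apply/negP => /andP[/eqP -> /eqP ab]; rewrite ab eqxx in ba.
have loadx x : x != a -> x != b -> load cl' (e :: B) x = load cl B x.
  move=> xa xb; rewrite /load /= ed.1 eq_sym (negbTE xb) add0n.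
  apply: eq_count => f /=; rewrite /cl'; case: (eqVneq (cl _) a) => [->|//].
  by rewrite ![_ == x]eq_sym (negbTE xa) (negbTE xb).
exists h', cl', lv, N'; split.
- move=> f; rewrite inE orbCA => /orP[/eqP->|/i1 H]; first by rewrite ed.1 ed.2.
  by rewrite /cl' H.
- move=> x; rewrite /h' /cl'; case: eqP => xa; last exact: i2.
  have H1 := i2 x; have H2 := i2 (src t0); have H3 := i2 (dst t0).
  rewrite -/b in H2; rewrite -/a in H3; rewrite xa in H1.
  have H4 : (m %| (c t0 - (g (src t0) - g (dst t0)))%R)%Z.
    by apply: c_g; apply: contra eM; apply: KM.
  have -> : (h x + d + g x - lv b = (h x + g x - lv a)
     + (h (src t0) + g (src t0) - lv b) - (h (dst t0) + g (dst t0) - lv a)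
     + (c t0 - (g (src t0) - g (dst t0))))%R by rewrite /d /fall; ring.
  by rewrite rpredD // rpredB // rpredD.
- move=> x; rewrite /h' /cl'; have := i3 x; case: eqP => [xa|/eqP xa].
    rewrite loadb xa.
    (* The fall across [t0] was at most 1 for [h0], the source has risen by at most the load of [b],
       and the target has not sunk: [d] is at most that load plus one. *)
    have := d1 t0 eM; have := i3 (src t0); have := i3 (dst t0).
    by move: d0; rewrite -/a -/b /d /fall; lia.
  case: (eqVneq (cl x) b) => [->|xb]; last by rewrite loadx.
  by rewrite loadb; lia.
- move=> x t; rewrite /N' /cl'; case: (eqVneq x a) => [->|xa].
    rewrite inE; case: (eqVneq (cl (src t)) a) => [_|/negbTE->]; last by rewrite andbF.
    by rewrite (negbTE ba) /= andbF.
  case: (eqVneq x b) => [->|xb].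
    rewrite !inE !i4.
    case: (eqVneq (cl (dst t)) a) => [_|da]; first by rewrite eqxx !andbF.
    case: (eqVneq (cl (dst t)) b) => [_|db]; first by rewrite !andbF.
    case: (eqVneq (cl (src t)) a) => [->|sa]; first by rewrite eqxx; lia.
    by rewrite /= andbF /= !andbT.
  rewrite i4; congr (_ && _).
  have -> : ((if cl (src t) == a then b else cl (src t)) == x) = (cl (src t) == x).
    by case: (eqVneq (cl (src t)) a) => // ->; rewrite ![_ == x]eq_sym (negbTE xa) (negbTE xb).
  congr (_ && _); case: (eqVneq (cl (dst t)) a) => // ->.
  by rewrite ![_ == x]eq_sym (negbTE xa) (negbTE xb).
move=> x; rewrite /N'; case: (eqVneq x a) => [_|xa].
  have s0 j : steep h' fset0 j = fset0 by apply/fsetP=> t; rewrite in_steep inE.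
  by rewrite !s0 cardfs0.
(* Darts starting outside [a] never get steeper, so the other regions keep their bounds. *)
have sub t : cl (src t) != a -> (fall h' t <= fall h t)%R.
  by rewrite /fall /h' => /negbTE ->; case: eqP; lia.
case: (eqVneq x b) => [->|xb]; last first.
  rewrite loadx //; have [b1 b2 b3] := i5 x; split=> //;
  [apply: leq_trans b2|apply: leq_trans b3]; 
  apply/fsubset_leq_card/fsubsetP=> t; rewrite !in_steep i4 => /andP[/and3P[-> /eqP sx ->]];
  have := sub t; rewrite sx => /(_ xa); rewrite eqxx /=; lia.
rewrite loadb.
set Nb := [fset t in _ | _].
have t0b : t0 \in N b by rewrite i4 eqxx /= eM eq_sym.
have t0a : rev t0 \in N a by rewrite i4 dst_rev -/a -/b eqxx /= eM.
have [a1 a2 a3] := i5 a; have [b1 b2 b3] := i5 b.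
have cardD t (A : {fset E * bool}) : t \in A -> #|` A| = #|` A `\ t|.+1.
  by move=> tA; rewrite (cardfsD1 t) tA.
have ca := cardD _ _ t0a; have cb := cardD _ _ t0b.
have subU (X Y Z : {fset E * bool}) : X `<=` Y `|` Z -> #|` X| <= #|` Y| + #|` Z|.
  move=> /fsubset_leq_card H; apply: leq_trans H _.
  by rewrite cardfsU leq_subr.
have memNb t : t \in Nb -> (t \in N a `\ rev t0) /\ fall h' t = (fall h t + d)%R \/
    (t \in N b `\ t0) /\ fall h' t = fall h t.
  rewrite !inE !i4 => /andP[/orP[] /and3P[-> /eqP H _] /andP[/negbTE da /negbTE db]];
    [left|right]; rewrite /fall /h' H da ?eqxx; split.
  - rewrite /= andbT; apply/eqP=> tt.
    by move: db; rewrite tt dst_rev -/b eqxx.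
  - by ring.
  - rewrite db /= andbT; apply/eqP=> tt.
    by move: da; rewrite tt -/a eqxx.
  - by rewrite (negbTE ba).
have szN : #|` Nb| <= #|` N a `\ rev t0| + #|` N b `\ t0|.
  by apply: subU; apply/fsubsetP => t /memNb [] [H _]; rewrite in_fsetU H ?orbT.
have szs (i j : int) : (i + d <= j)%R ->
    #|` steep h' Nb j| <= #|` steep h (N a `\ rev t0) i| + #|` steep h (N b `\ t0) j|.
  move=> ij; apply: subU; apply/fsubsetP => t; rewrite in_steep => /andP[/memNb H].
  case: H => [[H E1]|[H E1]]; rewrite in_fsetU E1 => jd; apply/orP; [left|right];
   rewrite in_steep H /=; lia.
have low (j : int) : exists i : int, (i + d <= j)%R by exists (j - d)%R; lia.
have sta (j : int) : #|` steep h (N a `\ rev t0) j| <= #|` N a `\ rev t0|.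
  by apply/fsubset_leq_card/fsubsetP=> t; rewrite in_steep => /andP[].
have sta' (j : int) : #|` steep h (N a `\ rev t0) j| <= #|` steep h (N a) j|.
  apply/fsubset_leq_card/fsubsetP=> t; rewrite !in_steep in_fsetD1.
  by move=> /andP[/andP[_ ->]].
have stb (j : int) : (j <= d)%R ->
    #|` steep h (N b `\ t0) j| < #|` steep h (N b) j|.
  move=> jd; rewrite (cardD t0 (steep h (N b) j)); last by rewrite in_steep t0b.
  rewrite ltnS; apply/fsubset_leq_card/fsubsetP=> t; rewrite in_steep in_fsetD1 in_fsetD1 in_steep.
  by move=> /andP[/andP[-> ->]].
have stb' (j : int) : #|` steep h (N b `\ t0) j| <= #|` steep h (N b) j|.
  apply/fsubset_leq_card/fsubsetP=> t; rewrite !in_steep in_fsetD1.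
  by move=> /andP[/andP[_ ->]].
clearbody d.
split; first by lia.
(* If [d >= 1], all [2i+3] remaining darts of [a] may become steep, but [t0] was a steep dart of [b]
   and is lost, which leaves [2j] there. If [d = 0], the old counts simply add up. *)
- case: (leP 1%R d) => d1'.
    have [i Hi] := low 1%R; have := szs i 1%R Hi.
    have := sta i; have := stb 1%R d1'; lia.
  have H1 : (1 + d <= 1)%R by lia.
  have := szs 1%R 1%R H1; have := sta' 1%R; have := stb' 1%R; lia.
(* For [d >= 2] the same count gives [(2i+3) + (2j-1)]. For [d = 1] the darts of [a] that had fall
   at least 1 join the steep ones: [(2i+1) + 2j]. *)
case: (leP 2%R d) => d2.
  have [i Hi] := low 2%R; have := szs i 2%R Hi.
  have := sta i; have := stb 2%R d2; lia.
case: (leP 1%R d) => d1'.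
  have H1 : (1 + d <= 2)%R by lia.
  have := szs 1%R 2%R H1; have := sta' 1%R; have := stb' 2%R; lia.
have H2 : (2 + d <= 2)%R by lia.
have := szs 2%R 2%R H2; have := sta' 2%R; have := stb' 2%R; lia.
Qed.


Lemma merged_step (Mk Del : pred E) h0 B (e : E) :
  {subset K <= Mk} -> ~~ Mk e -> (forall t, ~~ Mk t.1 -> (fall h0 t <= 1)%R) ->
  merged Mk Del h0 B -> merged Mk Del h0 (e :: B).
Proof.
move=> KM eM d1 [h [cl [lv [N [i1 i2 i3 i4 i5]]]]].
case: (eqVneq (cl (src (e, true))) (cl (src (e, false)))) => [clE|cle].
  have le x : load cl B x <= load cl (e :: B) x by apply: leq_addl.
  exists h, cl, lv, N; split=> // [f|x|x].
  - by rewrite inE orbCA => /orP[/eqP->|/i1].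
  - by have := i3 x; have := le (cl x); lia.
  by have [] := i5 x; have := le x; split; lia.
have [s d0] : exists s, (0 <= fall h (e, s))%R.
  case: (leP 0%R (fall h (e, true))) => d0; first by exists true.
  by exists false; rewrite -[(e, false)]/(rev (e, true)) fall_rev; lia.
apply: (merged_step_lt KM eM d1 i1 i2 i3 i4 i5 _ d0).
by case: s {d0}; rewrite /dst /rev //= eq_sym.
Qed.

Lemma merged_all (Mk Del : pred E) h0 B :
  {subset K <= Mk} -> (forall t, ~~ Mk t.1 -> (fall h0 t <= 1)%R) ->
  all (predC Mk) B -> merged Mk Del h0 [::] -> merged Mk Del h0 B.
Proof.
move=> KM d1 + H0; elim: B => [//|e B IH] /= /andP[eM /IH].
exact: merged_step.
Qed.

(** Each edge of [B] is counted once, under its own region; so budgets of twice the load add up to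
    twice the size of [B]. *)
Lemma sum_load (B : seq E) (cl : F -> F) :
  \sum_(a <- undup [seq cl (src (e, true)) | e <- B]) load cl B a = size B.
Proof.
set s := map _ _; have <- : size s = size B by rewrite size_map.
rewrite -(perm_size (perm_count_undup s)) size_flatten /shape -map_comp sumnE big_map.
by apply: eq_bigr => a _; rewrite /= size_nseq /load count_map.
Qed.

Lemma response (q : nat) (Mk Del : pred E) (B : seq E) :
  q.+1 < m -> {subset K <= Mk} -> invariant Mk Del ->
  size B <= q -> all (predC Mk) B ->
  exists M : seq E, [/\ size M <= 2 * q,
    forall e, e \in M -> [&& ~~ Mk e, ~~ Del e & e \notin B]
  & invariant (fun e => Mk e || (e \in M)) (fun e => Del e || (e \in B))].
Proof.
move=> qm KM [h0 [cl0 [lv0 [N0 [j1 j2 d1 j4 j5]]]]] sB BM.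
have : merged Mk Del h0 B.
  apply: merged_all => //; exists h0, cl0, lv0, N0; split=> //.
  - by move=> e; rewrite orbF => /j1.
  - by move=> x; rewrite subrr lexx.
case=> h [cl [lv [N [i1 i2 i3 i4 i5]]]].
(* In each region claim the darts of fall at least 2, then others of fall at least 1, then any
   others, up to twice the load. *)
have /choice[C HC] : forall a, exists C : {fset E * bool},
    [/\ C `<=` N a, #|` C| <= 2 * load cl B a, steep h (N a) 2%R `<=` C,
     #|` steep h (N a) 1%R `\` C| <= 1 & #|` N a `\` C| <= 4].
  move=> a; have [b1 b2 b3] := i5 a.
  have s21 : steep h (N a) 2%R `<=` steep h (N a) 1%R.
    by apply/fsubsetP => t; rewrite !in_steep => /andP[-> /=]; lia.
  have s10 : steep h (N a) 1%R `<=` N a by apply/fsubsetP => t; rewrite in_steep => /andP[].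
  have [Y [Y1 Y2 Y3 Y4]] := fset_between s21 b3.
  have [Z [Z1 Z2 Z3 Z4]] := fset_between (fsubset_trans Y2 s10) Y3.
  exists Z; split=> //; first exact: fsubset_trans Z1.
    by apply: leq_trans (fsubset_leq_card (fsetDS _ Z1)) _; lia.
  by lia.
pose labels := undup [seq cl (src (e, true)) | e <- B].
pose M := flatten [seq [seq t.1 | t <- enum_fset (C a)] | a <- labels].
have CM a t : t \in C a -> t.1 \in M.
  move=> tC; apply/flatten_mapP; exists a; last exact: map_f.
  have [_ H _ _ _] := HC a.
  have : 0 < load cl B a.
    rewrite lt0n; apply/eqP => l0; move: H; rewrite l0 muln0 leqn0 cardfs_eq0.
    by move=> /eqP C0; rewrite C0 in tC.
  by rewrite mem_undup -has_count => /hasP[e eB /eqP <-]; apply: map_f.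
exists M; split.
- rewrite size_flatten /shape -map_comp sumnE big_map.
  apply: leq_trans (_ : 2 * size B <= _); last by rewrite leq_mul2l.
  rewrite -(sum_load B cl) big_distrr /=; apply: leq_sum => a _.
  by rewrite size_map; have [] := HC a.
- move=> e /flatten_mapP[a _ /mapP[t tC ->]].
  have [/fsubsetP sC _ _ _ _] := HC a.
  have := sC _ tC; rewrite i4 => /and3P[-> /eqP sa da].
  (* A claimed dart changes region, whereas a deleted edge has both sides in one region. *)
  rewrite -negb_or; apply: contra da => /i1 H; apply/eqP; rewrite -sa.
  by move: H; rewrite /dst /rev; case: t {tC sa} => f [] /=.
have sub : {subset Mk <= (fun e => Mk e || (e \in M))}.
  by move=> e eM; apply/orP; left.
exists h, cl, lv, (fun a => [fset t in N a | ~~ (Mk t.1 || (t.1 \in M))]); split=> //.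
- move=> t /norP[tM tM']; rewrite leNgt; apply/negP => d2.
  case: (eqVneq (cl (src t)) (cl (dst t))) => [E1|E1]; last first.
    have [_ _ /fsubsetP s2 _ _] := HC (cl (src t)).
    move/negP: tM'; apply; apply: (CM (cl (src t))); apply: s2.
    by rewrite in_steep i4 tM eqxx eq_sym E1 /=; lia.
  (* Inside a region the fall is a multiple of [m]. As levels rise by at most [q], it is at most
     [q + 1 < m], hence not positive. *)
  have : (m %| fall h t)%Z.
    have H4 : (m %| (c t - (g (src t) - g (dst t)))%R)%Z.
      by apply: c_g; apply: contra tM; apply: KM.
    have H2 := i2 (src t); have H3 := i2 (dst t); rewrite -E1 in H3.
    have -> : fall h t = ((c t - (g (src t) - g (dst t)))
      + (h (src t) + g (src t) - lv (cl (src t)))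
      - (h (dst t) + g (dst t) - lv (cl (src t))))%R by rewrite /fall; ring.
    by rewrite rpredB // rpredD.
  have ub : (fall h t <= 1 + q%:Z)%R.
    have := d1 _ tM; have := i3 (src t); have := i3 (dst t).
    have : load cl B (cl (src t)) <= size B by apply: count_size.
    rewrite /fall; lia.
  case/dvdzP => k kE; move: (fall h t) kE d2 ub => x -> d2 ub.
  have [k0|k0] : (k <= 0)%R \/ (1 <= k)%R by lia.
    have : (k * m%:Z <= 0)%R by nia.
    lia.
  have : (m%:Z <= k * m%:Z)%R by nia.
  lia.
- exact: leaving_restrict i4.
move=> a; have [_ _ s2 s1 s0] := HC a.
have nC t : t \in [fset t in N a | ~~ (Mk t.1 || (t.1 \in M))] -> t \in N a `\` C a.
  rewrite !inE /= negb_or => /and3P[-> _ tM]; rewrite andbT.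
  by apply: contra tM; apply: CM.
split.
- by apply: leq_trans s0; apply/fsubset_leq_card/fsubsetP.
- apply: leq_trans s1; apply/fsubset_leq_card/fsubsetP => t.
  rewrite in_steep => /andP[/nC]; rewrite !in_fsetD in_steep.
  by move=> /andP[-> ->].
rewrite muln0 leqn0 cardfs_eq0; apply/eqP/fsetP => t; rewrite in_fset0.
apply/negP; rewrite in_steep => /andP[/nC]; rewrite in_fsetD => /andP[/negP tC tN] d2.
by apply: tC; apply: (fsubsetP s2); rewrite in_steep tN.
Qed.

End Merging.

(** * The square lattice with its initial flow and potential *)

Local Notation vert := (int * int)%type.
Local Notation gedge := (int * int * bool)%type.

(* [(v, true)] is the edge from [v] to its right neighbour, [(v, false)] the edge
   from [v] to the vertex above; a square is named by its lower left corner. *)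
Definition side (t : gedge * bool) : vert :=
  let: ((x, y), horizontal, s) := t in
  if horizontal then (if s then (x, y) else (x, y - 1)%R)
  else (if s then (x - 1, y)%R else (x, y)).

Definition tail (t : gedge * bool) : vert :=
  let: ((x, y), horizontal, s) := t in
  if s then (x, y) else if horizontal then (x + 1, y)%R else (x, y + 1)%R.

Arguments tail : simpl never.

Definition rows (m : nat) (t : gedge * bool) : int :=
  let: ((x, y), horizontal, s) := t in
  if [&& horizontal, (0 <= x)%R, (0 <= y)%R & (y < m%:Z)%R]
  then (if s then 1%R else (-1)%R) else 0%R.

(** A potential of [rows] modulo [m]. It is cut along the upward half-line from the origin, where it
    jumps by [y + 1] up to height [m] and by [m] from there on; so modulo [m] the cut is just the
    [spine], of [m - 1] edges. *)
Definition height (m : nat) (a : vert) : int :=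
  let: (x, y) := a in
  if ((x < 0) || (y < 0))%R then 0%R else if (m%:Z <= y)%R then (m%:Z)%R else (y + 1)%R.

Definition spine (m : nat) (e : gedge) : bool :=
  let: ((x, y), horizontal) := e in
  [&& ~~ horizontal, x == 0%R, (0 <= y)%R & (y + 1 < m%:Z)%R].

Lemma rows_rev m t : rows m (rev t) = (- rows m t)%R.
Proof.
by case: t => [[[x y] d] s]; rewrite /rows /rev /=; case: ifP => // _;
  case: s => //=; rewrite opprK.
Qed.

Lemma rows_height m t : ~~ spine m t.1 ->
  (m %| (rows m t - (height m (side t) - height m (dst side t)))%R)%Z.
Proof.
move=> H; set z := (_ - _)%R.
have [->|[->|->]] : z = 0%R \/ z = (m%:Z)%R \/ z = (- m%:Z)%R; last 1 first.
- by rewrite rpredN dvdzz.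
- rewrite /z {z}; move: H; case: t => [[[x y] d] s]; rewrite /dst /rev /spine /rows /height /=.
  by case: d; case: s => /=; do ! case: ifP; lia.
- by rewrite dvdz0.
by rewrite dvdzz.
Qed.

Definition darts_from (a : vert) : seq (gedge * bool) :=
  let: (x, y) := a in
  [:: ((x, y), true, true); ((x, y + 1)%R, true, false);
      ((x + 1, y)%R, false, true); ((x, y), false, false)].

Lemma mem_darts_from a t : (t \in darts_from a) = (side t == a).
Proof.
case: a => x y; case: t => [[[x' y'] d] s]; rewrite /darts_from !inE !xpair_eqE /side.
by case: d; case: s; rewrite ?andbT ?andbF ?orbF /= ?xpair_eqE //; apply/idP/idP; lia.
Qed.

Lemma dst_side_neq t : dst side t != side t.
Proof.
case: t => [[[x y] d] s]; rewrite /dst /rev /side /=.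
by case: d; case: s; rewrite /= xpair_eqE; lia.
Qed.

Lemma card_seq_fset_le (T : choiceType) (s : seq T) (P : pred T) :
  #|` [fset t in s | P t]| <= size s.
Proof.
rewrite (leq_trans _ (size_undup s)) //; apply: uniq_leq_size; first exact: fset_uniq.
by move=> t; rewrite mem_undup !inE => /andP[].
Qed.

(** Each square is its own region. It has four sides, and flow leads to a lower square at most
    through its bottom side. *)
Lemma invariant_init m (Mk : pred gedge) :
  invariant side (rows m) (height m) m Mk pred0.
Proof.
have fallE t : fall side (rows m) (fun=> 0%R) t = rows m t by rewrite /fall addr0 subr0.
have rows1 t : (rows m t <= 1)%R.
  by case: t => [[[x y] d] s]; rewrite /rows; case: ifP => //; case: s.
exists (fun=> 0%R), id, (height m), (fun a => [fset t in darts_from a | ~~ Mk t.1]).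
split=> //.
- by move=> x; rewrite add0r subrr dvdz0.
- by move=> t _; rewrite fallE.
- move=> a t; rewrite !inE /= mem_darts_from andbC; congr (_ && _).
  by case: eqP => //= <-; rewrite dst_side_neq.
move=> a; split.
- by apply: leq_trans (card_seq_fset_le _ _) _; case: a.
- apply: leq_trans (card_seq_fset_le [:: (a, true, true)] predT).
  apply/fsubset_leq_card/fsubsetP => t.
  rewrite in_steep fallE !inE andbT => /andP[/andP[]].
  case: a => x y; rewrite !inE => /or4P[] /eqP -> //=.
  by case: ifP.
rewrite muln0 leqn0 cardfs_eq0; apply/eqP/fsetP => t; rewrite in_fset0.
by apply/negP; rewrite in_steep fallE => /andP[_]; have := rows1 t; lia.
Qed.

(** * Divergence, and escape from finite vertex sets *)

Definition darts_out (v : vert) : seq (gedge * bool) :=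
  let: (x, y) := v in
  [:: ((x, y), true, true); ((x - 1, y)%R, true, false);
      ((x, y), false, true); ((x, y - 1)%R, false, false)].

Lemma mem_darts_out v t : (t \in darts_out v) = (tail t == v).
Proof.
case: v => x y; case: t => [[[x' y'] d] s]; rewrite /darts_out !inE !xpair_eqE /tail.
by case: d; case: s; rewrite ?andbT ?andbF ?orbF /= ?xpair_eqE //; apply/idP/idP; lia.
Qed.

(** Around a vertex the levels [h] telescope away, leaving the sources of [rows]. *)
Lemma divergence m h x y :
  (\sum_(t <- darts_out (x, y)) fall side (rows m) h t =
   [&& x == 0, 0 <= y & y < m%:Z]%:Z)%R.
Proof.
rewrite !big_cons big_nil /fall /dst /rev /rows /side /= ?andbT.
by do ! case: ifP; lia.
Qed.

Lemma escape m (Mk Del : pred gedge) (X : {fset vert}) :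
  1 < m -> {subset spine m <= Mk} -> (forall e, Del e -> ~~ Mk e) ->
  invariant side (rows m) (height m) m Mk Del ->
  (forall y : int, (0 <= y < m%:Z)%R -> (0%R, y) \in X) ->
  exists t, [/\ tail t \in X, tail (rev t) \notin X & ~~ Del t.1].
Proof.
move=> m1 KM DM [h [cl [lv [N [i1 i2 i3 _ _]]]]] KX.
apply: contrapT => noesc.
have bnd t : tail t \in X -> tail (rev t) \notin X -> Del t.1.
  move=> tX rX; apply/negPn/negP => D; apply: noesc; by exists t.
set fl := fall side (rows m) h in i3.
have flrev t : fl (rev t) = (- fl t)%R by apply: fall_rev; apply: rows_rev.
(* A deleted edge is interior to a region, so its flow is a multiple of [m]; being unclaimed, it
   also has flow of absolute value at most 1, and [1 < m]. *)
have fl0 t : Del t.1 -> fl t = 0%R.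
  move=> tD; have tM := DM _ tD.
  have up := i3 t tM; have := i3 (rev t) tM; rewrite flrev => lo.
  have clE : cl (side t) = cl (dst side t).
    by have := i1 _ tD; rewrite /dst /rev; case: t {tD tM up lo} => e [].
  have H4 : (m %| (rows m t - (height m (side t) - height m (dst side t)))%R)%Z.
    by apply: rows_height; apply: contra tM; apply: KM.
  have H2 := i2 (side t); have H3 := i2 (dst side t); rewrite -clE in H3.
  have : (m %| fl t)%Z.
    have -> : fl t = ((rows m t - (height m (side t) - height m (dst side t)))
      + (h (side t) + height m (side t) - lv (cl (side t)))
      - (h (dst side t) + height m (dst side t) - lv (cl (side t))))%R by rewrite /fl /fall; ring.
    by rewrite rpredB // rpredD.
  case/dvdzP => k; move: (fl t) up lo => z up lo zE.
  have [k0|[k0|k0]] : (k <= -1)%R \/ k = 0%R \/ (1 <= k)%R by lia.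
  - have : (k * m%:Z <= - m%:Z)%R by nia.
    lia.
  - by rewrite zE k0 mul0r.
  have : (m%:Z <= k * m%:Z)%R by nia.
  lia.
pose L := [seq t | v <- enum_fset X, t <- darts_out v].
have memL t : (t \in L) = (tail t \in X).
  apply/allpairsPdep/idP => [[v [u [vX + ->]]]|tX].
    by rewrite mem_darts_out => /eqP ->.
  by exists (tail t), t; rewrite mem_darts_out.
have uL : uniq L.
  apply: allpairs_uniq_dep => [|v _|]; first exact: fset_uniq.
    by case: v => x y; rewrite /darts_out /= !inE !xpair_eqE; lia.
  move=> [v t] [v' t'] /allpairsPdep[a [b [_ + [-> ->]]]]
    /allpairsPdep[a' [b' [_ + [-> ->]]]] /= E1.
  by rewrite !mem_darts_out -E1 => /eqP <- /eqP <-.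
(* Darts inside [X] cancel against their reverses; those leaving [X] are deleted and carry no
   flow. *)
have sum0 : (\sum_(t <- L) fl t = 0)%R.
  rewrite (bigID (fun t => tail (rev t) \in X)) /= [X in (_ + X)%R]big1_seq ?addr0; last first.
    by move=> t /andP[rX]; rewrite memL => tX; apply/fl0/bnd.
  rewrite -big_filter; set L' := filter _ _.
  have pL : perm_eq L' (map (@rev _) L').
    apply: uniq_perm; rewrite ?map_inj_uniq ?filter_uniq //; first exact: can_inj (@revK _).
    move=> t; rewrite -[in RHS](revK t) mem_map; last exact: can_inj (@revK _).
    by rewrite !mem_filter !memL revK andbC.
  have : (\sum_(t <- L') fl t = - \sum_(t <- L') fl t)%R.
    rewrite {1}(perm_big _ pL) /= big_map -sumrN; apply: eq_bigr => t _; exact: flrev.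
  by move/eqP; rewrite -subr_eq0 opprK -mulr2n mulrn_eq0 => /eqP.
have : (\sum_(t <- L) fl t =
    (count (fun v : vert => [&& v.1 == 0, 0 <= v.2 & v.2 < m%:Z]%R) (enum_fset X))%:Z)%R.
  rewrite big_allpairs_dep /=; elim: (enum_fset X) => [|[x y] s IH]; first by rewrite big_nil.
  by rewrite big_cons IH divergence /= PoszD.
rewrite sum0 => /eqP; rewrite eq_sym; apply/negP.
suff : 0 < count (fun v : vert => [&& v.1 == 0, 0 <= v.2 & v.2 < m%:Z]%R) (enum_fset X) by lia.
by rewrite -has_count; apply/hasP; exists (0%R, 0%R); [apply: KX; lia|rewrite /=; lia].
Qed.

(** * The edges of [Z2] in coordinates centred at [v0] *)

Definition edge_at (v0 : vert) (e : gedge) : {fset vert} :=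
  [fset (v0 + tail (e, true))%R; (v0 + tail (e, false))%R].

Lemma edge_at_Z2 v0 e : is_Z2_edge (edge_at v0 e).
Proof.
apply/existsP; exists [` fset21 _ _]; apply/existsP; exists [` fset22 _ _].
rewrite eqxx andbT; apply/eqP.
by case: e => [[x y] []]; rewrite /sqdist /tail /=; ring.
Qed.

Definition Zedge v0 e : edge Z2 := exist _ (edge_at v0 e) (edge_at_Z2 v0 e).

Lemma ends_Zedge v0 t :
  ends (Zedge v0 t.1) = [fset (v0 + tail t)%R; (v0 + tail (rev t))%R].
Proof. by case: t => e [] //; rewrite /rev /= fsetUC. Qed.

Lemma Zedge_inj v0 : injective (Zedge v0).
Proof.
move=> e e' /(congr1 val) /= /fsetP H.
have := H (v0 + tail (e, true))%R; have := H (v0 + tail (e, false))%R.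
have := H (v0 + tail (e', true))%R; have := H (v0 + tail (e', false))%R.
rewrite /edge_at !inE !eqxx !(inj_eq (addrI v0)) ?orbT /=.
case: e e' {H} => [[x y] d] [[x' y'] d']; rewrite /tail.
by case: d; case: d'; rewrite !xpair_eqE => H1 H2 H3 H4; congr (_, _, _); lia.
Qed.

Lemma Zedge_surj v0 (f : edge Z2) : exists e, Zedge v0 e = f.
Proof.
suff [e eE] : exists e, edge_at v0 e = val f by exists e; apply: val_inj.
case: f => f /= /existsP[[[x y] _] /existsP[[[x' y'] _] /= /andP[+ /eqP ->]]].
case: v0 => u v.
rewrite /sqdist /= => /eqP d1.
have E (e : gedge) a b : ((u, v) + tail (e, true))%R = a -> ((u, v) + tail (e, false))%R = b ->
    exists e, edge_at (u, v) e = [fset a; b] by move=> <- <-; exists e.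
have E' (e : gedge) a b : ((u, v) + tail (e, true))%R = b -> ((u, v) + tail (e, false))%R = a ->
    exists e, edge_at (u, v) e = [fset a; b] by move=> <- <-; exists e; rewrite fsetUC.
have pairE (a b a' b' : int) : a = a' -> b = b' -> (a, b) = (a', b') by move=> -> ->.
have [[dx dy]|[[dx dy]|[[dx dy]|[dx dy]]]] : (x' = x + 1 /\ y' = y \/ x' = x - 1 /\ y' = y \/
    x' = x /\ y' = y + 1 \/ x' = x /\ y' = y - 1)%R.
- have : (-1 <= x - x' <= 1)%R by nia.
  have : (-1 <= y - y' <= 1)%R by nia.
  nia.
- by apply: (E (x - u, y - v, true)%R); apply: pairE => /=; lia.
- by apply: (E' (x' - u, y - v, true)%R); apply: pairE => /=; lia.
- by apply: (E (x - u, y - v, false)%R); apply: pairE => /=; lia.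
by apply: (E' (x - u, y' - v, false)%R); apply: pairE => /=; lia.
Qed.

(** * Positions of the game and Maker's moves *)

Lemma fset_pad (T : choiceType) (f : nat -> T) (A M : {fset T}) n :
  injective f -> #|` M| <= n -> [disjoint M & A]%fset ->
  exists P : {fset T}, [/\ M `<=` P, #|` P| = n & [disjoint P & A]%fset].
Proof.
move=> fI Mn; have [k kE] : exists k, #|` M| + k = n by exists (n - #|` M|); lia.
elim: k M {Mn} kE => [|k IH] M kE MA; first by exists M; split=> //; lia.
have [i] : exists i, f i \notin A `|` M.
  apply: contrapT => H.
  have : size [seq f i | i <- iota 0 (#|` A `|` M|).+1] <= #|` A `|` M|.
    apply: uniq_leq_size; first by rewrite map_inj_uniq ?iota_uniq.
    move=> t /mapP[i _ ->]; apply/negPn/negP => fi; apply: H; by exists i.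
  by rewrite size_map size_iota ltnn.
rewrite in_fsetU negb_or => /andP[fA fM].
have [||P [P1 P2 P3]] := IH (f i |` M).
- by rewrite cardfsU1 fM; lia.
- by rewrite fdisjointUX fdisjoint1X fA.
by exists P; split=> //; apply: fsubset_trans P1; apply: fsubsetU1.
Qed.

Lemma card_image_seq (T T' : choiceType) (f : T -> T') (s : seq T) :
  #|` [fset f x | x in s]| <= size s.
Proof.
rewrite -(size_map f); apply: uniq_leq_size; first exact: fset_uniq.
by move=> y /imfsetP[x /= xs ->]; apply: map_f.
Qed.

(** Describes the moment just after Maker's move, so [Mk] includes it. With [m = 2q + 1] the spine
    has [2q] edges, affordable at once, and [q + 1 < m] holds for positive [q]. *)
Definition position (q : nat) (v0 : vert) (Mk Del : {fset edge Z2}) :=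
  let m := (2 * q).+1 in
  [/\ forall e, spine m e -> Zedge v0 e \in Mk, [disjoint Mk & Del]%fset
    & invariant side (rows m) (height m) m
        (fun e => Zedge v0 e \in Mk) (fun e => Zedge v0 e \in Del)].

Lemma position_infinite q (v0 : vertex Z2) Mk Del : 0 < q ->
  position q v0 Mk Del -> infinite_set (component Del v0).
Proof.
move=> q0 [KM MD inv] /finite_fsetP[X0 XE].
have memX w : w \in X0 <-> reach Del v0 w.
  have : (component Del v0) w <-> [set` X0]%classic w by rewrite XE.
  by rewrite /component /=; tauto.
pose X := [fset (w - v0)%R | w in X0].
have XP w : w \in X <-> reach Del v0 (v0 + w)%R.
  rewrite -memX; split=> [/imfsetP[u /= uX ->]|H]; first by rewrite addrC subrK.
  by apply/imfsetP; exists (v0 + w)%R => //=; rewrite addrAC subrr add0r.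
have step t : reach Del v0 (v0 + tail t)%R -> Zedge v0 t.1 \notin Del ->
    reach Del v0 (v0 + tail (rev t))%R.
  by move=> H D; apply: reach_step H D (ends_Zedge _ _).
have [|||y /andP[y0 ym]|t [tX rX tD]] := @escape (2 * q).+1 _ _ X _ _ _ inv.
- lia.
- by move=> e; apply: KM.
- by move=> e; rewrite /=; apply: contraL; apply: (fdisjointP MD).
(* Climb the spine from [v0]: its edges are claimed, hence never deleted. *)
- apply/XP; case: y y0 ym => // n _ nm; elim: n nm => [|n IH] nm.
    by rewrite addr0; exact: reach_refl.
  have := step (0, n%:Z, false, true)%R; rewrite /rev /tail /=.
  have -> : (n%:Z + 1 = n.+1%:Z)%R by lia.
  apply; first by apply: IH; lia.
  by apply: (fdisjointP MD); apply: KM; rewrite /spine /=; lia.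
by move/negP: rX; apply; apply/XP/step => //; apply/XP.
Qed.

(** A legal move has exactly [p] edges; the surplus is filled with edges of the row to the right of
    [v0], and extra claims never hurt the invariant. *)
Lemma position_extend p q v0 (M Mk Del : {fset edge Z2}) :
  #|` M| <= p -> [disjoint M & Del]%fset -> [disjoint M & Mk]%fset ->
  position q v0 (Mk `|` M) Del ->
  exists P : {fset edge Z2}, [/\ #|` P| = p, [disjoint P & Mk `|` Del]%fset
    & position q v0 (Mk `|` P) Del].
Proof.
move=> Mp MD MM [KM MkD inv].
have fI : injective (fun n => Zedge v0 (n%:Z, 0, true)%R) by move=> i j /Zedge_inj [].
have [||P [MP Pp PD]] := @fset_pad _ _ (Mk `|` Del) M p fI.
- by [].
- by rewrite fdisjointXU MM.
exists P; split=> //; split.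
- move=> e /KM; apply/fsubsetP; exact: fsetUS.
- move: MkD PD; rewrite !fdisjointUX fdisjointXU => /andP[-> _] /andP[_ ->] //.
apply: invariant_mono inv => e; apply/fsubsetP; exact: fsetUS.
Qed.

Lemma position_init p q v0 : 2 * q <= p ->
  exists P, #|` P| = p /\ position q v0 P fset0.
Proof.
move=> pq; pose K := [fset Zedge v0 (0, i%:Z, false)%R | i in iota 0 (2 * q)].
have KE e : spine (2 * q).+1 e -> Zedge v0 e \in K.
  case: e => [[x y] d] /and4P[/negbTE -> /eqP -> y0 ym]; apply/imfsetP.
  case: y y0 ym => // n _ nm; exists n => //=; rewrite mem_iota; lia.
have [||||P [P1 _ P3]] := @position_extend p q v0 K fset0 fset0.
- apply: leq_trans pq; apply: leq_trans (card_image_seq _ _) _.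
  by rewrite size_iota.
- exact: fdisjointX0.
- exact: fdisjointX0.
- rewrite fset0U; split=> //; first exact: fdisjointX0.
  exact: invariant_init.
by exists P; split=> //; rewrite fset0U in P3.
Qed.

Lemma position_response p q v0 (Mk Del B : {fset edge Z2}) :
  0 < q -> 2 * q <= p -> position q v0 Mk Del -> #|` B| = q -> [disjoint B & Mk]%fset ->
  exists P : {fset edge Z2}, [/\ #|` P| = p, [disjoint P & Mk `|` (Del `|` B)]%fset
    & position q v0 (Mk `|` P) (Del `|` B)].
Proof.
move=> q0 pq [KM MkD inv] Bq BM.
have /choice[unZ unZK] := Zedge_surj v0.
have ZK : cancel (Zedge v0) unZ by move=> e; apply: (@Zedge_inj v0); rewrite unZK.
pose Bs := [seq unZ f | f <- enum_fset B].
have BsE e : (e \in Bs) = (Zedge v0 e \in B).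
  apply/mapP/idP => [[f fB ->]|eB]; first by rewrite unZK.
  by exists (Zedge v0 e); rewrite ?ZK.
have [||||Ms [M1 M2 M3]] := response (@rows_rev (2 * q).+1) (@rows_height (2 * q).+1)
   (q := q) (B := Bs) _ _ inv.
- lia.
- by move=> e; apply: KM.
- by rewrite size_map Bq.
- apply/allP => e; rewrite BsE => eB; exact: (fdisjointP BM).
pose M := [fset Zedge v0 e | e in Ms].
have ME e : (Zedge v0 e \in M) = (e \in Ms).
  by rewrite mem_imfset //; apply: Zedge_inj.
apply: (@position_extend p q v0 M).
- by apply: leq_trans pq; apply: leq_trans M1; apply: card_image_seq.
- apply/fdisjointP => f /imfsetP[e /= /M2 /and3P[_ eD eB] ->].
  by rewrite in_fsetU negb_or eD -BsE.
- by apply/fdisjointP => f /imfsetP[e /= /M2 /and3P[eM _ _] ->].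
split.
- by move=> e /KM; apply/fsubsetP; apply: fsubsetUl.
- rewrite fdisjointUX !fdisjointXU MkD fdisjoint_sym BM /=.
  apply/andP; split; apply/fdisjointP => f /imfsetP[e /= /M2 /and3P[_ eD eB] ->] //.
  by rewrite -BsE.
have -> : (fun e => Zedge v0 e \in Mk `|` M) = (fun e => (Zedge v0 e \in Mk) || (e \in Ms)).
  by apply: funext => e; rewrite in_fsetU ME.
have -> : (fun e => Zedge v0 e \in Del `|` B) = (fun e => (Zedge v0 e \in Del) || (e \in Bs)).
  by apply: funext => e; rewrite in_fsetU BsE.
exact: M3.
Qed.

Theorem theorem1p3 (p q : nat) (v0 : vertex Z2) :
  (0 < p)%N -> (0 < q)%N -> (2 * q <= p)%N -> maker_wins v0 p q.
Proof.
move=> _ q0 pq.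
pose good (h : history Z2) M := #|` M| = p /\
  [disjoint M & safe h `|` deleted h]%fset /\
  position q v0 (safe h `|` M) (deleted h).
(* The default [fset0] is taken only at histories without a good move, which no play following [S]
   reaches. *)
pose S (h : history Z2) := xget fset0 [set M | good h M]%classic.
have goodS h : play q S h -> good h (S h).
  (* The induction is on the existence of a good move; that the chosen one is good then follows. *)
  move=> ph; apply: xgetPex; elim: ph => [|{}h B ph [M gM] [Bq Bl]].
    have [P [P1 P2]] := position_init v0 pq; exists P.
    rewrite /good /safe /deleted !big_nil /= !fset0U.
    by split=> //; split=> //; apply: fdisjointX0.
  have [Sp [SD Spos]] : good h (S h) by apply: xgetPex; exists M.
  have [|P [P1 P2 P3]] := position_response q0 pq Spos Bq.
    apply/fdisjointP => e /Bl[[e1 _] e2]; by rewrite in_fsetU negb_or e1.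
  by exists P; rewrite /= /good /safe /deleted !big_rcons /=.
exists S => h ph; have [Sp [SD Spos]] := goodS h ph; split; last exact: position_infinite q0 Spos.
split=> // e eS; have := fdisjointP SD e eS; rewrite in_fsetU negb_or => /andP[nS nD].
by split.
Qed.
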